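(* Given any dart $X$ in $\mathbb{R}$ which is not absolutely continuous and whose singular part (in the Lebesgue decomposition of its law with respect to Lebesgue measure) is compactly supported, there exists a nonnegative bounded payoff function $f$ with compact support such that $(X,f)$ is not reasonable.
   Context: A dart in $\mathbb{R}$ is a random variable $X$ taking values in $\mathbb{R}$. A payoff function is a measurable function $f:\mathbb{R}\to\mathbb{R}$ which is bounded from above. For $d>0$, $g_{X,f}(d):=\sup_{a\in\mathbb{R}}Ef(a+dX)$. The pair $(X,f)$ is reasonable if $g_{X,f}(d)$ is decreasing (i.e. non-increasing) in $d\in(0,\infty)$.
   Formalization: The dart X is additionally assumed not to be almost surely constant; for X = c a.s. the claim is false, since then g_{X,f}(d) = sup f for every d and every pair (X,f) is reasonable. *)

(* Defs.v *)
From HB Require Import structures.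
From mathcomp Require Import all_boot all_order all_algebra.
From mathcomp Require Import all_classical all_reals all_analysis.
From mathcomp Require Import measurable_realfun.
Set Implicit Arguments.
Unset Strict Implicit.
Unset Printing Implicit Defensive.
Import Order.TTheory GRing.Theory Num.Theory.
Import numFieldNormedType.Exports.
Local Open Scope classical_set_scope.
Local Open Scope ring_scope.

Definition payoff (R : realType) (f : R -> R) : Prop :=
  measurable_fun setT f /\ exists M : R, forall x, f x <= M.

(* Extended-real valued: a payoff function is only bounded from above, so the
   expectation may be -oo. *)
Definition best_payoff (d : measure_display) (T : measurableType d)
    (R : realType) (P : probability T R) (X : {RV P >-> R}) (f : R -> R)
    (delta : R) : \bar R :=
  ereal_sup [set 'E_P[fun w => f (a + delta * X w)%R] | a in [set: R]]%E.

Definition reasonable (d : measure_display) (T : measurableType d)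
    (R : realType) (P : probability T R) (X : {RV P >-> R}) (f : R -> R)
    : Prop :=
  {in `]0%R, +oo[ &, nonincreasing_fun (best_payoff X f)}.

Definition mutually_singular (d : measure_display) (T : measurableType d)
    (R : realType) (mu nu : set T -> \bar R) : Prop :=
  exists N : set T, [/\ measurable N, mu (~` N) = 0%E & nu N = 0%E].

(* By uniqueness of the decomposition, [ac] and [sing] are the absolutely
   continuous and the singular part of [mu] with respect to [nu]. *)
Definition lebesgue_decomposition (d : measure_display) (T : measurableType d)
    (R : realType) (mu nu : set T -> \bar R)
    (ac sing : {measure set T -> \bar R}) : Prop :=
  [/\ forall A, measurable A -> mu A = (ac A + sing A)%E,
      ac `<< nu & mutually_singular sing nu].

Definition measure_support (R : realType)
    (mu : {measure set R -> \bar R}) : set R :=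
  [set x | forall U : set R, open U -> U x -> (0 < mu U)%E].

Definition compactly_supported_measure (R : realType)
    (mu : {measure set R -> \bar R}) : Prop :=
  compact (measure_support mu).

Definition compactly_supported_fun (R : realType) (f : R -> R) : Prop :=
  compact (closure [set x | f x != 0]).

Definition as_constant (d : measure_display) (T : measurableType d)
    (R : realType) (P : probability T R) (X : {RV P >-> R}) : Prop :=
  exists c : R, {ae P, forall w, X w = c}.

(* A dart concentrated at a single point is reasonable for every payoff
   function, although its law is singular with compact support. *)
Lemma as_constant_reasonable (d : measure_display) (T : measurableType d)
    (R : realType) (P : probability T R) (X : {RV P >-> R}) (f : R -> R) :
  as_constant X -> payoff f -> reasonable X f.
Proof.
move=> [c Xc] [mf _].
have E (a t : R) : ('E_P[fun w => f (a + t * X w)%R] = (f (a + t * c)%R)%:E)%E.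
  rewrite unlock -[RHS]mule1 -(@probability_setT _ _ _ P) -integral_cst//.
  have mt : measurable_fun setT (fun x : R => a + t * x).
    by apply: measurable_funD => //; exact: measurable_funM.
  apply: ae_eq_integral => //.
    apply/measurable_EFinP; apply: (measurableT_comp mf).
    by apply: (measurableT_comp mt); exact: measurable_funPT.
  by apply: filterS Xc => w -> _.
have S (t : R) : best_payoff X f t = ereal_sup [set (f x)%:E | x in [set: R]].
  congr ereal_sup; apply/seteqP; split => y /= [a _ <-].
    by exists (a + t * c) => //; rewrite E.
  by exists (a - t * c) => //; rewrite E subrK.
by move=> s t _ _ _; rewrite !S.
Qed.

(* Main.v *)
Require Import Defs.
From HB Require Import structures.
From mathcomp Require Import all_boot all_order all_algebra.
From mathcomp Require Import all_classical all_reals all_analysis.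
From mathcomp Require Import measurable_realfun lra ring zify.
Import Order.TTheory GRing.Theory Num.Theory.
Import numFieldNormedType.Exports.
Local Open Scope classical_set_scope.
Local Open Scope ring_scope.

(** Write [nu] for the singular part of the law of [X] and choose a
    Lebesgue-null set [N] that carries it.  A payoff vanishing off [N]
    only sees [nu]: the affine preimages of [N] are null as well, so the
    absolutely continuous part contributes nothing at any scale
    ([null_supported_expectation]).  What remains is to compare the dilates of
    a finite, compactly supported measure.

    Suppose first that [nu] is not a point mass.  If every payoff function were
    reasonable, duality would make [nu], normalised, self-decomposable: for
    each [t < 1] it would be the law of [t Y + A], where [Y] has law [nu] and
    [A] is independent of [Y].  A compactly
    supported measure with this property has to be degenerate, because [A]
    would range over an interval of length proportional to [1 - t], so its
    variance is of order [(1 - t) ^ 2], whereas it should supply the missing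
    variance [(1 - t ^ 2) V], which is of order [1 - t].  The lemma
    [nondegenerate_dilation_gap] turns this obstruction into an explicit
    payoff, [(x - c) ^ 2 + Lam] on the convex hull [[m, M]] of the support and
    [0] outside, with [c] the barycentre of [nu].  For [t] close to [1], either
    the translation is small and the second moment about [c] drops, or the
    translation is large and pushes a definite amount of mass out of [[m, M]],
    which is ruinous when [Lam] is large.

    If [nu] is a point mass at [c], then [c] is the only atom of the law, and
    some further mass lies elsewhere.  The payoff is an indicator of [c] plus a
    multiple of the indicator of an annulus around [c] that has positive
    probability ([single_atom_unreasonable]).  At every scale it is worth
    aiming the atom exactly at [c]; doing so at a small scale asks the rest of
    the dart to be very far from [c] for it to hit the annulus, which is less
    likely than at scale [1]. *)

(** * Expected payoffs under affine changes of aim *)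

Lemma measurable_affine (R : realType) (a t : R) :
  measurable_fun [set: R] (fun x : R => a + t * x).
Proof. by apply: measurable_funD => //; exact: measurable_funM. Qed.

(** The image of Lebesgue measure under [x |-> a + t x], scaled by [t], is again
    Lebesgue measure, since the two agree on intervals. *)
Lemma lebesgue_null_affine (R : realType) (a t : R) (N : set R) :
  0 < t -> measurable N -> lebesgue_measure N = 0%E ->
  lebesgue_measure ((fun x => a + t * x) @^-1` N) = 0%E.
Proof.
move=> t0 mN N0.
pose phi : measurableTypeR R -> measurableTypeR R := fun x => a + t * x.
have mphi : measurable_fun [set: measurableTypeR R] phi.
  exact: measurable_affine.
(* [mu] takes the measurability of [phi], which makes the pushforward a
   measure, as an argument. *)
pose mu : {measure set measurableTypeR R -> \bar R} :=
  mscale (NngNum (ltW t0)) (pushforward lebesgue_measure phi).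
have muE A : mu mphi A = (t%:E * lebesgue_measure (phi @^-1` A))%E by [].
have : lebesgue_measure N = mu mphi N.
  apply: lebesgue_measure_unique => // _ [[u v] _ <-]; rewrite muE.
  have -> : phi @^-1` `]u, v]%classic = `](u - a) / t, (v - a) / t]%classic.
    apply/seteqP; split => x /=; rewrite !in_itv/= ltr_pdivrMr// ler_pdivlMr//.
      by rewrite /phi mulrC ltrBlDl lerBrDl.
    by rewrite /phi mulrC ltrBlDl lerBrDl.
  rewrite !lebesgue_measure_itv/= !lte_fin ltr_pM2r ?invr_gt0// ltrD2r.
  case: ifPn => _; last by rewrite mule0.
  by rewrite !EFinN -!EFinD -EFinM; congr (_%:E); field; exact: lt0r_neq0.
rewrite N0 muE => /esym/eqP; rewrite mule_eq0 eqe (gt_eqF t0)/=.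
by move=> /eqP.
Qed.

Lemma lebesgue_dominatesP (R : realType) (nu : {measure set R -> \bar R}) :
  null_dominates (lebesgue_measure : set R -> \bar R) nu <->
  forall A : set R, measurable A -> lebesgue_measure A = 0%E -> nu A = 0%E.
Proof. exact: (@null_content_dominatesP _ (measurableTypeR R)). Qed.

Lemma affine_expectation (d : measure_display) (T : measurableType d)
    (R : realType) (P : probability T R) (X : {RV P >-> R}) (f : R -> R)
    (a t : R) :
  measurable_fun [set: R] f -> (forall x, 0 <= f x) ->
  ('E_P[fun w => f (a + t * X w)%R] =
   \int[distribution P X]_x (f (a + t * x)%R)%:E)%E.
Proof.
move=> mf f0; rewrite unlock ge0_integral_distribution//.
  apply/measurable_EFinP; apply: (measurableT_comp mf).
  exact: measurable_affine.
by move=> y; rewrite lee_fin.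
Qed.

(** The payoff [x |-> f (a + t x)] is supported by an affine preimage of [N],
    which is a null set for the absolutely continuous part. *)
Lemma null_supported_expectation (d : measure_display) (T : measurableType d)
    (R : realType) (P : probability T R) (X : {RV P >-> R})
    (ac sing : {measure set R -> \bar R}) (N : set R) (f : R -> R) (a t : R) :
  (forall A, measurable A -> distribution P X A = (ac A + sing A)%E) ->
  ac `<< lebesgue_measure ->
  measurable N -> lebesgue_measure N = 0%E ->
  measurable_fun [set: R] f -> (forall x, 0 <= f x) ->
  (forall x, ~ N x -> f x = 0) -> 0 < t ->
  ('E_P[fun w => f (a + t * X w)%R] = \int[sing]_x (f (a + t * x)%R)%:E)%E.
Proof.
move=> lawE ac_leb mN N0 mf f0 fN t0; rewrite affine_expectation//.
have mfa : measurable_fun [set: R] (fun x => (f (a + t * x))%:E).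
  apply/measurable_EFinP; apply: (measurableT_comp mf).
  exact: measurable_affine.
have fa0 x : [set: R] x -> (0 <= (f (a + t * x))%:E)%E by rewrite lee_fin.
rewrite (eq_measure_integral (measure_add ac sing)); last first.
  by move=> A mA _; rewrite [RHS]measure_addE; exact: lawE.
rewrite ge0_integral_measure_add//.
rewrite [X in (X + _)%E](_ : _ = 0%E) ?add0e//.
pose N' := (fun x => a + t * x) @^-1` N.
have mN' : measurable N'.
  by rewrite -[N']setTI; apply: measurable_affine.
rewrite (@ge0_negligible_integral _ _ _ _ _ N')//; last first.
  by move/lebesgue_dominatesP : ac_leb; apply => //; exact: lebesgue_null_affine.
apply: integral0_eq => x [_ N'x]; congr (_%:E); exact: fN.
Qed.

(** Unreasonableness is always exhibited at scale [1] against a smaller scale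
    [t], by a single good aim [a0] and a bound [u] on all aims at scale [t]. *)
Lemma dilation_not_reasonable (d : measure_display) (T : measurableType d)
    (R : realType) (P : probability T R) (X : {RV P >-> R}) (f : R -> R)
    (t a0 : R) (u : \bar R) :
  0 < t -> t <= 1 -> (forall a, 'E_P[fun w => f (a + t * X w)%R] <= u)%E ->
  (u < 'E_P[fun w => f (a0 + 1 * X w)%R])%E -> ~ reasonable X f.
Proof.
move=> t0 t1 Et E1 Xf.
have : (best_payoff X f 1 <= best_payoff X f t)%E.
  by apply: Xf => //; rewrite in_itv/= andbT.
apply/negP; rewrite -ltNge; apply: (@le_lt_trans _ _ u).
  by apply: ge_ereal_sup => _ [a _ <-].
by apply: (lt_le_trans E1); apply: ereal_sup_ubound; exists a0.
Qed.

Lemma compactly_supported_within (R : realType) (f : R -> R) (m M : R) :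
  (forall x, ~ `[m, M]%classic x -> f x = 0) -> compactly_supported_fun f.
Proof.
move=> f_out; apply: (@subclosed_compact _ _ `[m, M]%classic).
- exact: closed_closure.
- exact: segment_compact.
- rewrite (_ : `[m, M]%classic = closure `[m, M]%classic); last first.
    by apply/closure_id; exact: interval_closed.
  apply: closure_subset => x /= /eqP fx; apply: contrapT => nx.
  by apply: fx; exact: f_out.
Qed.

Lemma between_bounded (R : realType) (f : R -> R) (B : R) :
  (forall x, 0 <= f x <= B) -> bounded_fun f.
Proof.
move=> fB; exists B; split; first exact: num_real.
move=> C BC x _ /=; have /andP[f0 fb] := fB x.
by rewrite ger0_norm//; apply: (le_trans fb); exact: ltW.
Qed.

(** * Support and second moment of a measure on the line *)

Lemma quadratic_integrable (R : realType) (nu : {measure set R -> \bar R})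
    (m M alpha beta gamma : R) :
  (nu `[m, M]%classic < +oo)%E ->
  nu.-integrable `[m, M] (EFin \o (fun x => alpha + beta * x + gamma * x ^+ 2)).
Proof.
move=> nufin; apply: measurable_bounded_integrable => //.
  apply: measurable_funD.
    by apply: measurable_funD => //; exact: measurable_funM.
  by apply: measurable_funM => //; exact: measurable_funX.
exists (`|alpha| + `|beta| * (`|m| + `|M|) + `|gamma| * (`|m| + `|M|) ^+ 2).
split; first exact: num_real.
move=> B ltB x /=; rewrite in_itv/= => /andP[mx xM].
apply: le_trans (ltW ltB).
have xmM : `|x| <= `|m| + `|M|.
  rewrite ler_norml; apply/andP; split.
    by have := ler_norm (- m); rewrite normrN; have := normr_ge0 M; lra.
  by have := ler_norm M; have := normr_ge0 m; lra.
apply: (le_trans (ler_normD _ _)); apply: lerD.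
  apply: (le_trans (ler_normD _ _)); rewrite lerD2l normrM.
  exact: ler_wpM2l.
rewrite normrM normrX; apply: ler_wpM2l => //.
by apply: lerXn2r => //; rewrite nnegrE// addr_ge0.
Qed.

(** With [c] the barycentre and [V] the second moment about [c], the linear
    term of a quadratic integrand centred at [c] disappears.  Only these
    consequences are kept, so that later computations are purely algebraic. *)
Lemma centered_second_moment (R : realType) (nu : {measure set R -> \bar R})
    (m M : R) :
  (nu `[m, M]%classic < +oo)%E -> (0 < nu `[m, M]%classic)%E ->
  exists c V : R,
    [/\ 0 <= V, V = 0 -> nu (`[m, M]%classic `\` [set c]) = 0%E
      & forall alpha beta gamma,
        (\int[nu]_(x in `[m, M]) ((alpha + beta * (x - c)) ^+ 2 + gamma)%:E =
         (alpha ^+ 2 * fine (nu `[m, M]%classic) + beta ^+ 2 * V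
          + gamma * fine (nu `[m, M]%classic))%:E)%E].
Proof.
move=> fin pos; set D := `[m, M]%classic; set s := fine (nu D).
have sE : nu D = s%:E by rewrite fineK// ge0_fin_numE.
have s0 : 0 < s by rewrite -lte_fin -sE.
have mD : measurable D by exact: measurable_itv.
pose I f := \int[nu]_(x in D) (f x : R).
have IE f : nu.-integrable D (EFin \o f) ->
    (\int[nu]_(x in D) (f x)%:E = (I f)%:E)%E.
  move=> If; rewrite /I /Rintegral fineK//.
  exact: (@integrable_fin_num _ _ _ _ _ mD (EFin \o f)).
have int1 : nu.-integrable D (EFin \o (fun=> 1)).
  have := @quadratic_integrable _ nu m M 1 0 0 fin.
  by apply: eq_integrable => // x _ /=; rewrite !mul0r !addr0.
have intx : nu.-integrable D (EFin \o (fun x => x)).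
  have := @quadratic_integrable _ nu m M 0 1 0 fin.
  by apply: eq_integrable => // x _ /=; rewrite !(mul0r, mul1r, addr0, add0r).
have intx2 : nu.-integrable D (EFin \o (fun x => x ^+ 2)).
  have := @quadratic_integrable _ nu m M 0 0 1 fin.
  by apply: eq_integrable => // x _ /=; rewrite !(mul0r, mul1r, addr0, add0r).
have I1 : (\int[nu]_(x in D) 1%:E = s%:E)%E by rewrite integral_cst// mul1e sE.
have IQ a b g : (\int[nu]_(x in D) (a + b * x + g * x ^+ 2)%:E =
    (a * s + b * I id + g * I (fun x => x ^+ 2))%:E)%E.
  rewrite (_ : (fun x => (_ + _)%:E) =
     (fun x => a%:E * 1%:E + b%:E * x%:E + g%:E * (x ^+ 2)%:E)%E); last first.
    by apply/funext => x; rewrite -!EFinM -!EFinD mulr1.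
  have ia : nu.-integrable D (fun x => a%:E * 1%:E)%E by exact: integrableZl.
  have ib : nu.-integrable D (fun x => b%:E * x%:E)%E by exact: integrableZl.
  have ig : nu.-integrable D (fun x => g%:E * (x ^+ 2)%:E)%E.
    exact: integrableZl.
  rewrite integralD//; last exact: integrableD.
  rewrite integralD// !integralZl//.
  by rewrite I1 (IE _ intx) (IE _ intx2) -!EFinM -!EFinD.
pose c := I id / s; pose V := I (fun x => x ^+ 2) - c ^+ 2 * s.
have csE : I id = c * s by rewrite /c divfK// gt_eqF.
have VE : (\int[nu]_(x in D) ((x - c) ^+ 2)%:E = V%:E)%E.
  transitivity (\int[nu]_(x in D) (c ^+ 2 + (- 2 * c) * x + 1 * x ^+ 2)%:E)%E.
    by apply: eq_integral => x _; congr (_%:E); ring.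
  by rewrite IQ csE /V; congr (_%:E); ring.
exists c, V; split.
- by rewrite -lee_fin -VE; apply: integral_ge0 => x _; rewrite lee_fin sqr_ge0.
- move=> V0.
  have mq : measurable_fun D (fun x : R => ((x - c) ^+ 2)%:E).
    apply/measurable_EFinP; apply: measurable_funX.
    by apply: measurable_funB.
  have /(ae_eq_integral_abs nu mD mq) :
      (\int[nu]_(x in D) `|((x - c) ^+ 2)%:E| = 0)%E.
    rewrite -[RHS](congr1 EFin V0) -VE; apply: eq_integral => x _.
    by rewrite gee0_abs// lee_fin sqr_ge0.
  move=> [A [mA A0 sA]]; apply: (@subset_measure0 _ _ _ nu _ A) => //.
    exact: measurableD.
  move=> x [Dx xc]; apply: sA => /= /(_ Dx) [] /eqP.
  by rewrite sqrf_eq0 subr_eq0 => /eqP.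
- move=> a b g.
  transitivity (\int[nu]_(x in D) ((a ^+ 2 - 2 * a * b * c + b ^+ 2 * c ^+ 2 + g)
     + (2 * a * b - 2 * b ^+ 2 * c) * x + b ^+ 2 * x ^+ 2)%:E)%E.
    by apply: eq_integral => x _; congr (_%:E); ring.
  by rewrite IQ csE /V; congr (_%:E); ring.
Qed.

(** The complement of the support is covered by its null intervals with
    rational endpoints, and there are countably many of these. *)
Lemma measure_support_null (R : realType) (nu : {measure set R -> \bar R}) :
  measurable (measure_support nu) -> nu (~` measure_support nu) = 0%E.
Proof.
move=> mK.
(* Enumerates the null intervals with rational endpoints. *)
pose F (n : nat) : set R := if unpickle n is Some (q, r) then
  (if nu `](ratr q : R), (ratr r : R)[%classic == 0%E
   then `](ratr q : R), (ratr r : R)[%classic else set0) else set0.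
apply/negligibleP; first exact: measurableC.
apply: (@negligibleS _ _ _ nu (\bigcup_n F n)); last first.
  apply: negligible_bigcup => n; rewrite /F.
  case: unpickle => [[q r]|]; last exact: negligible_set0.
  case: eqP => [qr0|_]; last exact: negligible_set0.
  by apply/negligibleP => //; exact: measurable_itv.
move=> x /= /existsNP[U /not_implyP[oU /not_implyP[Ux]]] /negP.
rewrite -leNgt => U0.
have : nbhs x U by exact: open_nbhs_nbhs.
rewrite -nbhs_ballE => -[e /= e0 xeU].
have [q] : exists q : rat, (ratr q : R) \in `](x - e), x[.
  by apply: rat_in_itvoo; rewrite ltrBlDr ltrDl.
rewrite in_itv/= => /andP[qe qx].
have [r] : exists r : rat, (ratr r : R) \in `]x, (x + e)[.
  by apply: rat_in_itvoo; rewrite ltrDl.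
rewrite in_itv/= => /andP[xr re].
suff qr0 : nu `](ratr q : R), (ratr r : R)[%classic == 0%E.
  exists (pickle (q, r)); first exact: I.
  by rewrite /F pickleK qr0 /= in_itv/= qx xr.
rewrite -measure_le0; apply: le_trans U0; apply: le_measure.
- by rewrite inE; exact: measurable_itv.
- by rewrite inE; exact: open_measurable.
move=> y /=; rewrite in_itv/= => /andP[qy yr]; apply: xeU.
by rewrite /ball/= ltr_distlC; lra.
Qed.

(** The endpoints are the extrema of the support: any one-sided neighbourhood of
    them contains support points in an open set, hence has positive measure. *)
Lemma compact_support_hull (R : realType) (nu : {measure set R -> \bar R}) :
  compactly_supported_measure nu -> nu setT <> 0%E ->
  exists m M : R, [/\ nu (~` `[m, M]%classic) = 0%E,
    forall e, 0 < e -> nu (`[m, M] `&` `]M - e, +oo[) <> 0%E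
    & forall e, 0 < e -> nu (`[m, M] `&` `]-oo, m + e[) <> 0%E].
Proof.
move=> cK nuT; set K := measure_support nu in cK.
have mK : measurable K.
  by apply: closed_measurable; apply: compact_closed.
have K0 : nu (~` K) = 0%E by exact: measure_support_null.
have K_neq0 : K !=set0.
  apply/set0P/eqP => Ke; apply: nuT; move: K0.
  by rewrite Ke setC0.
have sK := compact_has_sup K_neq0 cK.
have iK : has_inf K.
  split=> //; have [B [_ KB]] := compact_bounded cK.
  exists (- (B + 1)) => x Kx; have B1 : B < B + 1 by rewrite ltrDl.
  have /= := KB _ B1 x Kx.
  by rewrite ler_norml => /andP[].
have KD : K `<=` `[inf K, sup K].
  move=> x Kx /=; rewrite in_itv/=; apply/andP; split.
    by apply: ge_inf => //; case: iK.
  by apply: ub_le_sup => //; case: sK.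
have D0 : nu (~` `[inf K, sup K]%classic) = 0%E.
  apply: (@subset_measure0 _ _ _ nu _ (~` K)) => //; try exact: measurableC.
  exact: subsetC.
have posD U x : open U -> U x -> K x ->
    nu (`[inf K, sup K] `&` U) <> 0%E.
  move=> oU Ux Kx; have mU : measurable U by exact: open_measurable.
  move=> DU0.
  have : (0 < nu U)%E by exact: Kx.
  rewrite -(setIT U) -(setUv `[inf K, sup K]%classic) setIUr.
  rewrite measureU0 ?(setIC U) ?DU0 ?ltxx//.
  - exact: measurableI.
  - by apply: measurableI => //; exact: measurableC.
  - apply: (@subset_measure0 _ _ _ nu _ (~` `[inf K, sup K]%classic)) => //.
    + by apply: measurableI => //; exact: measurableC.
    + exact: measurableC.
exists (inf K), (sup K); split=> // e e0.
- have [x Kx xe] := sup_adherent e0 sK.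
  by apply: (posD _ x) => //=; rewrite in_itv/= xe.
- have [x Kx xe] := inf_adherent e0 iK.
  by apply: (posD _ x) => //=; rewrite in_itv/= xe.
Qed.

(** * Dilating a measure that is not a point mass *)

(** Quantitative failure of self-decomposability.  Take [t = 1 - r] and let
    [b = a + t c - c] be the displacement of the barycentre.
    - If [`|b| <= r L], the dilated quadratic integrates to at most
      [b ^+ 2 * s + t ^+ 2 * V <= (r L) ^+ 2 * s + (1 - r) ^+ 2 * V], which is
      less than [V] because the gain is quadratic in [r] and the loss linear.
    - Otherwise the mass within [r] of the endpoint in the direction of [b]
      leaves [[m, M]] altogether; that mass is positive and independent of
      [a], so a large constant [Lam] makes the move a losing one. *)
Lemma nondegenerate_dilation_gap (R : realType)
    (nu : {measure set R -> \bar R}) (m M : R) :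
  (nu `[m, M]%classic < +oo)%E ->
  nu (~` `[m, M]%classic) = 0%E ->
  (forall e, 0 < e -> nu (`[m, M] `&` `]M - e, +oo[) <> 0%E) ->
  (forall e, 0 < e -> nu (`[m, M] `&` `]-oo, m + e[) <> 0%E) ->
  (forall c, nu (~` [set c]) <> 0%E) ->
  exists (h : R -> R) (B t u : R),
    [/\ measurable_fun [set: R] h, forall x, 0 <= h x <= B,
       forall x, ~ `[m, M]%classic x -> h x = 0, 0 < t < 1 &
       (forall a, (\int[nu]_x (h (a + t * x)%R)%:E <= u%:E)%E) /\
       (u%:E < \int[nu]_x (h x)%:E)%E].
Proof.
move=> fin out topM topm nondeg; set D := `[m, M]%classic.
have mD : measurable D by exact: measurable_itv.
have finS A : measurable A -> A `<=` D -> nu A \is a fin_num.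
  move=> mA AD; rewrite ge0_fin_numE//; apply: le_lt_trans fin.
  by apply: le_measure => //; rewrite inE.
have posS A : measurable A -> A `<=` D -> nu A <> 0%E -> 0 < fine (nu A).
  move=> mA AD /eqP A0; rewrite fine_gt0// lt0e A0 measure_ge0/=.
  by rewrite -ge0_fin_numE//; exact: finS.
have D0 : nu D <> 0%E.
  move=> D0; apply: (topM 1 ltr01).
  by apply: (@subset_measure0 _ _ _ nu _ D) => //; exact: measurableI.
set s := fine (nu D); have s0 : 0 < s by exact: posS.
have sE : nu D = s%:E by rewrite fineK//; exact: finS.
have [|c [V [Vge0 Vc moments]]] := @centered_second_moment _ nu m M fin.
  by rewrite sE lte_fin.
have V0 : 0 < V.
  rewrite lt_neqAle Vge0 andbT; apply/eqP => /esym/Vc DC.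
  apply: (nondeg c).
  have U0 : nu (~` D `|` (D `\` [set c])) = 0%E.
    by rewrite measureU0//; [exact: measurableC|exact: measurableD].
  apply: (@subset_measure0 _ _ _ nu _ (~` D `|` (D `\` [set c]))).
  - exact: measurableC.
  - by apply: measurableU; [exact: measurableC|exact: measurableD].
  - by move=> x xc; have [Dx|nDx] := pselect (D x); [right|left].
  - exact: U0.
(* The extra [1] leaves room for a displacement beyond [r L] to push out
   everything within distance [r] of an endpoint. *)
pose L := `|M - c| + `|m - c| + 1.
have L1 : 1 <= L.
  by rewrite /L; have := normr_ge0 (M - c); have := normr_ge0 (m - c); lra.
have ML : M - c + 1 <= L.
  by rewrite /L; have := ler_norm (M - c); have := normr_ge0 (m - c); lra.
have mL : - L <= m - c - 1.
  rewrite /L; have := ler_norm (- (m - c)); rewrite normrN.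
  by have := normr_ge0 (M - c); lra.
have Ls0 : 0 < L ^+ 2 * s + V.
  have : 0 <= L ^+ 2 * s by rewrite mulr_ge0 ?sqr_ge0// ltW.
  lra.
(* Chosen so that [r (L^2 s + V) < 2 V], that is
   [(r L)^2 s + (1 - r)^2 V < V]. *)
pose r := V / (2 * (L ^+ 2 * s + V)).
have rE : r * (L ^+ 2 * s + V) = V / 2 by rewrite /r; field; rewrite gt_eqF.
have r0 : 0 < r by rewrite divr_gt0// mulr_gt0.
have r1 : r < 1 by nra.
pose t := 1 - r.
have mtop : measurable (D `&` `]M - r, +oo[%classic) by apply: measurableI.
have mbot : measurable (D `&` `]-oo, m + r[%classic) by apply: measurableI.
set ptop := fine (nu (D `&` `]M - r, +oo[%classic)).
set pbot := fine (nu (D `&` `]-oo, m + r[%classic)).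
have ptop0 : 0 < ptop by apply: posS => //; exact: topM.
have pbot0 : 0 < pbot by apply: posS => //; exact: topm.
(* Large enough that losing mass [ptop] or [pbot] from a payoff worth at
   least [Lam] outweighs the at most [L^2 s] that the quadratic can bring. *)
pose Lam := L ^+ 2 * s / ptop + L ^+ 2 * s / pbot.
have qtop0 : 0 <= L ^+ 2 * s / ptop by rewrite divr_ge0//; nra.
have qbot0 : 0 <= L ^+ 2 * s / pbot by rewrite divr_ge0//; nra.
have Lam0 : 0 <= Lam by rewrite addr_ge0.
have Lam_top : L ^+ 2 * s <= Lam * ptop.
  by rewrite mulrDl divfK ?gt_eqF// lerDl mulr_ge0// ltW.
have Lam_bot : L ^+ 2 * s <= Lam * pbot.
  by rewrite /Lam [X in X * pbot]addrC mulrDl divfK ?gt_eqF// lerDl mulr_ge0// ltW.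
pose h y := ((y - c) ^+ 2 + Lam) * \1_D y.
have mh : measurable_fun [set: R] h.
  apply: measurable_funM; last exact: measurable_indic.
  apply: measurable_funD => //; apply: measurable_funX.
  exact: measurable_funB.
have h_out x : ~ D x -> h x = 0.
  by move=> nDx; rewrite /h indicE memNset// mulr0.
have h_in x : D x -> h x = (x - c) ^+ 2 + Lam.
  by move=> Dx; rewrite /h indicE mem_set// mulr1.
have h_quad x : 0 <= h x <= (x - c) ^+ 2 + Lam.
  have := sqr_ge0 (x - c).
  by have [/h_in ->|/h_out ->] := pselect (D x); lra.
have h_bound x : 0 <= h x <= L ^+ 2 + Lam.
  have [Dx|/h_out ->] := pselect (D x); last by nra.
  rewrite (h_in _ Dx); move: Dx; rewrite /D/= in_itv/= => /andP[mx xM].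
  have := sqr_ge0 (x - c).
  have : (x - c) ^+ 2 <= L ^+ 2 by nra.
  lra.
pose u := (r * L) ^+ 2 * s + t ^+ 2 * V + Lam * s.
have mhD (f : R -> R) A : measurable_fun [set: R] f -> measurable A ->
    measurable_fun A (fun x => (h (f x))%:E).
  move=> mf mA; apply/measurable_EFinP; apply: (measurable_funS measurableT) => //.
  exact: measurableT_comp mh mf.
have intD (f : R -> R) : measurable_fun [set: R] f ->
    (\int[nu]_x (h (f x))%:E = \int[nu]_(x in D) (h (f x))%:E)%E.
  move=> mf; rewrite (@ge0_negligible_integral _ _ _ _ setT (~` D))//.
  - by rewrite setTD setCK.
  - exact: measurableC.
  - exact: mhD.
  - by move=> x _; rewrite lee_fin; have /andP[] := h_bound (f x).
exists h, (L ^+ 2 + Lam), t, u; split => //; first by rewrite /t; lra.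
split; last first.
  rewrite (intD id)// (_ : (\int[nu]_(x in D) _)%E =
    \int[nu]_(x in D) ((0 + 1 * (x - c)) ^+ 2 + Lam)%:E)%E; last first.
    by apply: eq_integral => x /set_mem Dx; rewrite (h_in _ Dx) add0r mul1r.
  rewrite moments lte_fin -/s -/D /u /t; nra.
move=> a; have ma := measurable_affine R a t.
rewrite (intD _ ma).
pose k := L ^+ 2 + Lam; have k0 : 0 <= k by rewrite /k; nra.
have escape U : measurable U -> L ^+ 2 * s <= Lam * fine (nu (D `&` U)) ->
    (forall x, U x -> ~ D (a + t * x)) ->
    (\int[nu]_(x in D) (h (a + t * x))%:E <= u%:E)%E.
  move=> mU Lamp Uout; have mDU : measurable (D `\` U) by exact: measurableD.
  have mkDU : measurable_fun D (fun x => (k%:E * (\1_(D `\` U) x)%:E)%E).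
    apply: emeasurable_funM => //; apply/measurable_EFinP.
    exact: measurable_indic.
  apply: (@le_trans _ _ (\int[nu]_(x in D) (k%:E * (\1_(D `\` U) x)%:E))%E).
    apply: ge0_le_integral => //.
    - by move=> x _; rewrite lee_fin; have /andP[] := h_bound (a + t * x).
    - exact: mhD.
    move=> x Dx; rewrite -EFinM lee_fin.
    have [Ux|nUx] := pselect (U x).
      by rewrite h_out ?mulr_ge0//; exact: Uout.
    by rewrite indicE mem_set// mulr1; have /andP[] := h_bound (a + t * x).
  rewrite ge0_integralZl_EFin//; last first.
    by apply/measurable_EFinP; exact: measurable_indic.
  rewrite integral_indic// (_ : (D `\` U) `&` D = D `\` U); last first.
    by apply/setIidl => x [].
  have : nu D = (nu (D `\` U) + nu (D `&` U))%E by rewrite -measureDI.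
  have f1 : nu (D `\` U) \is a fin_num by apply: finS => // x [].
  have f2 : nu (D `&` U) \is a fin_num.
    by apply: finS => //; exact: measurableI.
  move: Lamp; rewrite sE -(fineK f1) -(fineK f2) -!EFinD -EFinM lee_fin /=.
  move=> Lamp -[ses]; rewrite /k /u.
  have p0 : 0 <= fine (nu (D `&` U)) by rewrite fine_ge0.
  move: (fine (nu (D `&` U))) (fine (nu (D `\` U))) ses Lamp p0 => p q ses Lamp p0.
  have -> : q = s - p by lra.
  have := sqr_ge0 (r * L); have := sqr_ge0 t; have := sqr_ge0 L.
  nra.
pose b := a + t * c - c.
have bE x : a + t * x - c = b + t * (x - c) by rewrite /b; ring.
have [bL|] := lerP `|b| (r * L).
  apply: (@le_trans _ _ (\int[nu]_(x in D) ((b + t * (x - c)) ^+ 2 + Lam)%:E)%E).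
    apply: ge0_le_integral => //.
    - by move=> x _; rewrite lee_fin; have /andP[] := h_bound (a + t * x).
    - exact: mhD.
    - apply/measurable_EFinP; apply: measurable_funD => //.
      apply: measurable_funX; apply: measurable_funD => //.
      by apply: measurable_funM => //; exact: measurable_funB.
    by move=> x _; rewrite lee_fin -bE; have /andP[] := h_quad (a + t * x).
  rewrite moments lee_fin -/D -/s /u !lerD2r ler_pM2r//.
  have rL0 : 0 <= r * L by apply: mulr_ge0; lra.
  rewrite -[b ^+ 2]real_normK ?num_real//.
  by apply: lerXn2r; rewrite ?nnegrE.
rewrite ltr_normr => /orP[bL|bL]; last first.
- apply: (escape `]-oo, m + r[%classic) => // x /=; rewrite in_itv/= => xm.
  rewrite /D/= in_itv/= => /andP[+ _].
  have := bE x; rewrite /t in bE *; nra.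
- apply: (escape `]M - r, +oo[%classic) => // x /=; rewrite in_itv/= andbT => xM.
  rewrite /D/= in_itv/= => /andP[_].
  have := bE x; rewrite /t in bE *; nra.
Qed.

(** * A law with a single atom *)

Lemma measurable_dist_ge (R : realType) (c B : R) :
  measurable [set x : R | B <= `|x - c|].
Proof.
rewrite (_ : [set _ | _] =
    (fun x : R => `|x - c|) @^-1` `[B, +oo[%classic); last first.
  by apply/seteqP; split => x /=; rewrite in_itv/= andbT.
rewrite -[X in measurable X]setTI.
have : measurable_fun [set: R] (fun x : R => `|x - c|).
  by apply: measurableT_comp => //; exact: measurable_funB.
by apply => //; exact: measurable_itv.
Qed.

(** Continuity from above: the sets [[set x | n <= `|x - c|]] decrease to the
    empty set. *)
Lemma measure_far_lt (R : realType) (mu : {measure set R -> \bar R}) (c : R)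
    (q : \bar R) :
  (mu setT < +oo)%E -> (0 < q)%E ->
  exists2 B : R, 0 < B & (mu [set x | (B <= `|x - c|)%R] < q)%E.
Proof.
move=> fin q0; pose F (n : nat) := [set x : R | n%:R <= `|x - c|].
have mF n : measurable (F n) by exact: measurable_dist_ge.
have : (mu \o F) n @[n --> \oo] --> mu (\bigcap_n F n).
  apply: nonincreasing_cvg_mu => //.
  - by apply: le_lt_trans fin; apply: le_measure; rewrite ?inE.
  - exact: bigcapT_measurable.
  - move=> n k nk; apply/subsetPset => x /=; apply: le_trans.
    by rewrite ler_nat.
rewrite (_ : \bigcap_n F n = set0) ?measure0; last first.
  apply/seteqP; split => // x /= Fx.
  have := Fx (Num.truncn `|x - c|).+1 I; rewrite /F/=; apply/negP.
  by rewrite -ltNge truncnS_gt.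
have nq : nbhs (0 : \bar R)%E [set y | (y < q)%E].
  by apply: open_nbhs_nbhs; split => //; exact: open_ereal_lt_ereal.
move=> /(_ _ nq) [n _ nF]; exists n.+1%:R => //.
exact: (nF n.+1 (leqnSn n)).
Qed.

(** Countably many annuli cover the complement of [c], so they cannot all be
    null. *)
Lemma measure_annulus_gt0 (R : realType) (mu : {measure set R -> \bar R})
    (c : R) :
  mu (~` [set c]) <> 0%E ->
  exists e B : R, 0 < e /\
    mu ([set x | e <= `|x - c|] `&` `[c - B, c + B]) <> 0%E.
Proof.
move=> muc; apply: contrapT => /forallNP annulus0; apply: muc.
pose A (n : nat) : set R :=
  [set x | n.+1%:R^-1 <= `|x - c|] `&` `[c - n%:R, c + n%:R].
have mA n : measurable (A n).
  by apply: measurableI; [exact: measurable_dist_ge|exact: measurable_itv].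
apply/negligibleP; first exact: measurableC.
apply: (@negligibleS _ _ _ mu (\bigcup_n A n)); last first.
  apply: negligible_bigcup => n; apply/negligibleP => //.
  have /forallNP/(_ n%:R) := annulus0 n.+1%:R^-1.
  by move=> /not_andP[|/contrapT//]; rewrite invr_gt0.
move=> x /eqP xc; have d0 : 0 < `|x - c| by rewrite normr_gt0 subr_eq0.
pose n1 := (Num.truncn `|x - c|).+1; pose n2 := (Num.truncn `|x - c|^-1).+1.
have h1 : `|x - c| < n1%:R by exact: truncnS_gt.
have h2 : `|x - c|^-1 < n2%:R by exact: truncnS_gt.
exists (n1 + n2)%N => //; split => /=.
  rewrite -[leRHS]invrK lef_pV2 ?posrE ?invr_gt0//.
  by rewrite (le_trans (ltW h2))// ler_nat; lia.
rewrite in_itv/= -ler_distlC -normrN opprB.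
by rewrite (le_trans (ltW h1))// ler_nat leq_addr.
Qed.

(** The weight [p] of the annulus is the mass of the atom, so that an aim
    missing [c] with the atom earns at most [p], the atom's own reward. *)
Lemma single_atom_unreasonable (d : measure_display) (T : measurableType d)
    (R : realType) (P : probability T R) (X : {RV P >-> R}) (c : R) :
  distribution P X [set c] <> 0%E ->
  (forall y, y <> c -> distribution P X [set y] = 0%E) ->
  distribution P X (~` [set c]) <> 0%E ->
  exists f : R -> R,
    [/\ payoff f, forall x, 0 <= f x, bounded_fun f, compactly_supported_fun f
      & ~ reasonable X f].
Proof.
set mu := distribution P X => muc muy /measure_annulus_gt0[e [B [e0]]].
set A := _ `&` _ => /eqP muA.
have fin S : measurable S -> mu S \is a fin_num by move=> mS; exact: fin_num_measure.
have mA : measurable A.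
  by apply: measurableI; [exact: measurable_dist_ge|exact: measurable_itv].
have mu_setT : (mu setT < +oo)%E by rewrite -ge0_fin_numE//; exact: fin.
have muA0 : (0 < mu A)%E by rewrite lt0e muA measure_ge0.
have [B' B'0 far] := @measure_far_lt R (distribution P X) c _ mu_setT muA0.
set far_set := [set x | _] in far.
have mfar : measurable far_set by exact: measurable_dist_ge.
pose p := fine (mu [set c]).
have pE : mu [set c] = p%:E by rewrite fineK//; exact: fin.
have p0 : 0 < p.
  by rewrite -lte_fin -pE lt0e measure_ge0 andbT; exact/eqP.
have p1 : p <= 1 by rewrite -lee_fin -pE; exact: probability_le1.
pose f x := \1_[set c] x + p * \1_A x.
have mf : measurable_fun [set: R] f.
  apply: measurable_funD; first exact: measurable_indic.
  by apply: measurable_funM => //; exact: measurable_indic.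
have ind01 (S : set R) x : 0 <= (\1_S x : R) <= 1.
  by rewrite indicE ler0n lern1 leq_b1.
have f02 x : 0 <= f x <= 2.
  by have := ind01 [set c] x; have := ind01 A x; rewrite /f; nra.
have EfE a t : ('E_P[fun w => f (a + t * X w)%R] =
    mu ((fun x => a + t * x)%R @^-1` [set c]) +
    p%:E * mu ((fun x => a + t * x)%R @^-1` A))%E.
  have mpre S : measurable S -> measurable ((fun x => a + t * x)%R @^-1` S).
    by move=> mS; rewrite -[X in measurable X]setTI; exact: measurable_affine.
  rewrite affine_expectation//; last by move=> x; have /andP[] := f02 x.
  transitivity (\int[mu]_x
      ((\1_((fun x => a + t * x)%R @^-1` [set c]) x)%:E
       + p%:E * (\1_((fun x => a + t * x)%R @^-1` A) x)%:E))%E; first by [].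
  rewrite ge0_integralD//.
  - rewrite ge0_integralZl_EFin//; last 2 first.
    + apply/measurable_EFinP; apply: measurable_indic; exact: mpre.
    + exact: ltW.
    by rewrite !integral_indic ?setIT//; exact: mpre.
  - by apply/measurable_EFinP; apply: measurable_indic; exact: mpre.
  - by move=> x _; rewrite -EFinM lee_fin mulr_ge0// ltW.
  - apply: emeasurable_funM => //.
    by apply/measurable_EFinP; apply: measurable_indic; exact: mpre.
exists f; split.
- by split=> //; exists 2 => x; have /andP[] := f02 x.
- by move=> x; have /andP[] := f02 x.
- exact: between_bounded f02.
- apply: (@compactly_supported_within _ _ (Num.min c (c - B)) (Num.max c (c + B))).
  move=> x nx; rewrite /f !indicE !memNset ?mulr0 ?addr0//.
  + move=> [_ /=]; rewrite in_itv/= => xB; apply: nx => /=.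
    by rewrite in_itv/= ge_min le_max; move: xB => /andP[-> ->]; rewrite !orbT.
  + by move=> /= xc; apply: nx; rewrite /= in_itv/= xc ge_min le_max lexx.
(* At this scale a point of the annulus is reached only from distance at
   least [e / t = B' + e] from [c]. *)
pose t := e / (B' + e).
have Be : 0 < B' + e by rewrite addr_gt0.
have t0 : 0 < t by rewrite divr_gt0.
have t1 : t <= 1 by rewrite ler_pdivrMr// mul1r lerDr ltW.
have tB : t * B' <= e.
  by rewrite /t mulrAC ler_pdivrMr// mulrDr lerDl mulr_ge0// ltW.
apply: (@dilation_not_reasonable _ _ _ _ X f t 0 (p%:E + p%:E * mu far_set)%E) => //.
  move=> a; rewrite EfE; have [ac|ac] := eqVneq (a + t * c) c.
  - rewrite (_ : _ @^-1` [set c] = [set c]); last first.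
      apply/seteqP; split => x /=; last by move=> ->.
      rewrite -[in RHS]ac => /addrI/mulfI; apply.
      by rewrite gt_eqF.
    rewrite pE leeD2l// lee_pmul2l//; apply: le_measure; rewrite ?inE//.
      by rewrite -[X in measurable X]setTI; exact: measurable_affine.
    move=> x [/= ex _]; rewrite /far_set/=.
    have xE : a + t * x - c = t * (x - c).
      by rewrite -[a](addrK (t * c)) ac; ring.
    move: ex; rewrite xE normrM (gtr0_norm t0) => ex.
    by rewrite -(ler_pM2l t0); exact: le_trans tB ex.
  - rewrite (_ : _ @^-1` [set c] = [set (c - a) / t]); last first.
      apply/seteqP; split => x /=.
        by move=> <-; field; rewrite gt_eqF.
      by move=> ->; field; rewrite gt_eqF.
    rewrite muy ?add0e; last first.
      move=> ct; move/eqP : ac; apply; rewrite -{1}ct; field.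
      by rewrite gt_eqF.
    apply: (@le_trans _ _ p%:E).
      rewrite -[leRHS]mule1 lee_pmul2l//; apply: probability_le1.
      by rewrite -[X in measurable X]setTI; exact: measurable_affine.
    by rewrite leeDl// mule_ge0// lee_fin ltW.
rewrite EfE (_ : (fun x => 0 + 1 * x) = id); last first.
  by apply/funext => x; rewrite add0r mul1r.
rewrite !preimage_id pE lteD2lE//; rewrite lte_pmul2l//.
Qed.

(** * Darts with a compactly supported singular part *)

Theorem theorem1p17 (d : measure_display) (T : measurableType d)
    (R : realType) (P : probability T R) (X : {RV P >-> R})
    (ac sing : {measure set R -> \bar R})
    (X_nonconstant : ~ as_constant X)
    (X_not_ac : ~ (distribution P X `<< lebesgue_measure))
    (X_decomp : lebesgue_decomposition (distribution P X)
                  lebesgue_measure ac sing)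
    (sing_compact : compactly_supported_measure sing) :
  exists f : R -> R,
    [/\ payoff f, forall x, 0 <= f x, bounded_fun f, compactly_supported_fun f
      & ~ reasonable X f].
Proof.
have [lawE ac_leb [N [mN singN lebN]]] := X_decomp.
have ac0 A : measurable A -> lebesgue_measure A = 0%E -> ac A = 0%E.
  by move=> mA A0; move/lebesgue_dominatesP : ac_leb; exact.
have sing_fin A : measurable A -> (sing A < +oo)%E.
  move=> mA; apply: (@le_lt_trans _ _ (distribution P X A)).
    by rewrite lawE// leeDr.
  by rewrite -ge0_fin_numE// fin_num_measure.
have singT : sing setT <> 0%E.
  move=> s0; apply: X_not_ac; apply/lebesgue_dominatesP => A mA A0.
  apply: etrans (lawE _ mA) _; rewrite ac0// add0e.
  exact: (@subset_measure0 _ _ _ sing _ setT).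
have [m [M [out topM topm]]] := @compact_support_hull _ sing sing_compact singT.
have [[c c1]|nondeg] := pselect (exists c, sing (~` [set c]) = 0%E).
  have law1 y : distribution P X [set y] = sing [set y].
    by rewrite lawE// ac0 ?add0e//; exact: lebesgue_measure_set1.
  have mCc : measurable (~` [set c] : set R) by exact: measurableC.
  apply: (@single_atom_unreasonable _ _ _ P X c).
  - rewrite law1 => c0; apply: singT.
    by rewrite -(setUv [set c]) measureU0.
  - move=> y yc; rewrite law1.
    apply: (@subset_measure0 _ _ _ sing _ (~` [set c])) => //.
    by move=> x ->.
  - move=> lawc; apply: X_nonconstant; exists c.
    exists (X @^-1` (~` [set c])); split => //.
    by rewrite -[X in measurable X]setTI; exact: measurable_funPT.
have [||h [B [t [u [mh hB h_out /andP[t0 t1] [h_le h_gt]]]]]] :=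
  @nondegenerate_dilation_gap _ sing m M _ out topM topm.
- exact: sing_fin.
- by move=> c c0; apply: nondeg; exists c.
pose f x := h x * \1_N x.
have fh x : 0 <= f x <= h x.
  have /andP[h0 _] := hB x.
  by rewrite /f indicE; case: (_ \in _); rewrite ?mulr1 ?mulr0 ?h0 ?lexx.
have f0 x : 0 <= f x by have /andP[] := fh x.
have fB x : 0 <= f x <= B.
  by rewrite f0/=; have /andP[_ /le_trans] := fh x; apply; have /andP[] := hB x.
have mf : measurable_fun [set: R] f.
  by apply: measurable_funM => //; exact: measurable_indic.
have fN x : ~ N x -> f x = 0 by move=> Nx; rewrite /f indicE memNset// mulr0.
have fE a s : 0 < s -> ('E_P[fun w => f (a + s * X w)%R] =
    \int[sing]_x (f (a + s * x)%R)%:E)%E.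
  exact: (@null_supported_expectation _ _ _ P X ac sing N).
exists f; split => //.
- by split => //; exists B => x; have /andP[] := fB x.
- exact: between_bounded fB.
- apply: (@compactly_supported_within _ _ m M) => x /h_out hx.
  by rewrite /f hx mul0r.
have mEaff (k : R -> R) a : measurable_fun [set: R] k ->
    measurable_fun [set: R] (fun x => (k (a + t * x))%:E).
  move=> mk; apply/measurable_EFinP; apply: (measurableT_comp mk).
  exact: measurable_affine.
apply: (@dilation_not_reasonable _ _ _ _ X f t 0 u%:E) => //; first exact: ltW.
  move=> a; rewrite fE//; apply: le_trans (h_le a).
  apply: ge0_le_integral => //; try exact: mEaff.
  - by move=> x _; rewrite lee_fin.
  - by move=> x _; rewrite lee_fin; have /andP[] := fh (a + t * x).
(* Aiming at [0] with scale [1], restricting [h] to [N] costs nothing, since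
   [N] carries the singular part. *)
rewrite fE//; apply: (lt_le_trans h_gt); rewrite le_eqVlt; apply/orP; left.
apply/eqP; apply: ge0_ae_eq_integral => //.
- exact/measurable_EFinP.
- by apply/measurable_EFinP; apply: (measurableT_comp mf); exact: measurable_affine.
- by move=> x _; rewrite lee_fin; have /andP[] := hB x.
- by move=> x _; rewrite lee_fin.
exists (~` N); split => //; first exact: measurableC.
move=> x /= hx Nx; apply: hx => _.
by rewrite add0r mul1r /f indicE mem_set// mulr1.
Qed.
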